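(* Let $p \ge 5$ be a prime and let $a,b$ be integers with $\gcd(a,p)=1$ such that the cubic polynomial $x^3+ax+b$ is irreducible modulo $p$. Let $c_0,c_1,c_2$ be any integers such that $x^p \equiv c_2x^2+c_1x+c_0 \bmod \langle x^3+ax+b\rangle$ in $\mathbb{F}_p[x]$. Then $c_2$ is invertible modulo $p$, and setting $t \equiv (3a)(c_2)^{-1} \pmod p$, we have \[ t^2 \equiv -(4a^3+27b^2) \pmod p. \]
   Context: Here $x^p \bmod \langle f \rangle$ denotes the remainder of $x^p$ upon division by $f$ in $\mathbb{F}_p[x]$, i.e. reduction in the quotient ring $\mathbb{F}_p[x]/\langle f\rangle$; coefficients are taken modulo $p$. *)

(* Defs.v *)
From mathcomp Require Export all_boot all_order all_algebra.
Import GRing.Theory.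
Local Open Scope ring_scope.

Definition cubic_mod (p : nat) (a b : int) : {poly 'F_p} :=
  'X^3 + (a%:~R)%:P * 'X + (b%:~R)%:P.

Definition quadratic_mod (p : nat) (c2 c1 c0 : int) : {poly 'F_p} :=
  (c2%:~R)%:P * 'X^2 + (c1%:~R)%:P * 'X + (c0%:~R)%:P.

(* Main.v *)
Require Import Defs.
From mathcomp Require Import all_field ring.
Set Implicit Arguments.
Unset Strict Implicit.
Import GRing.Theory.
Local Open Scope ring_scope.

(** Let [x, y = x^p, z = y^p] be the roots of the cubic in an extension of
    [F_p], and let [g] be the quadratic polynomial representing [X^p], so that
    [g] permutes the roots cyclically. The symmetric sums of [g x], [x * g x]
    and [(g x)^2] over the three roots can be computed both from this cyclic
    action and from Newton's identities; eliminating [c0] and [c1] leaves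
    [c2^2 (4 a^3 + 27 b^2) = - 9 a^2]. As [p] does not divide [9 a^2], [c2] is
    a unit, and dividing by [c2^2] gives the claim. *)

Lemma quadratic_cycle_discriminant (R : comNzRingType) (a b c0 c1 c2 x y z : R) :
    x + y + z = 0 -> x * y + y * z + z * x = a -> x * y * z = - b ->
    c2 * x ^+ 2 + c1 * x + c0 = y ->
    c2 * y ^+ 2 + c1 * y + c0 = z ->
    c2 * z ^+ 2 + c1 * z + c0 = x ->
  c2 ^+ 2 * (4 * a ^+ 3 + 27 * b ^+ 2) = - (9 * a ^+ 2).
Proof.
move=> sum0 /esym aE e3 gx gy gz.
have zE : z = - x - y by rewrite -[RHS]addr0 -sum0; ring.
have bE : b = - (x * y * z) by rewrite e3 opprK.
(* With [g] the quadratic, [E1], [E2] and [E3] evaluate the sums of [g x], [x * g x] and [(g x)^2].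
   The cyclic action makes these 0, [a] and [- 2 * a]; the power sums of degrees 1 to 4 are 0,
   [- 2 * a], [- 3 * b] and [2 * a ^+ 2]. *)
have E1 : 3 * c0 - 2 * a * c2 = 0.
  transitivity ((c2 * x ^+ 2 + c1 * x + c0) + (c2 * y ^+ 2 + c1 * y + c0)
                + (c2 * z ^+ 2 + c1 * z + c0)).
    by rewrite aE zE; ring.
  by rewrite gx gy gz -sum0; ring.
have E2 : - 3 * b * c2 - 2 * a * c1 - a = 0.
  transitivity (x * (c2 * x ^+ 2 + c1 * x + c0) + y * (c2 * y ^+ 2 + c1 * y + c0)
                + z * (c2 * z ^+ 2 + c1 * z + c0) - a).
    by rewrite bE aE zE; ring.
  by rewrite gx gy gz aE; ring.
have E3 : 2 * a ^+ 2 * c2 ^+ 2 - 6 * b * c1 * c2 - 2 * a * (c1 ^+ 2 + 2 * c2 * c0)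
          + 3 * c0 ^+ 2 + 2 * a = 0.
  transitivity ((c2 * x ^+ 2 + c1 * x + c0) ^+ 2 + (c2 * y ^+ 2 + c1 * y + c0) ^+ 2
                + (c2 * z ^+ 2 + c1 * z + c0) ^+ 2 + 2 * a).
    by rewrite bE aE zE; ring.
  by rewrite gx gy gz aE zE; ring.
apply/eqP; rewrite -subr_eq0 opprK; apply/eqP.
(* The square of [E1] cancels the terms in [c0]. With [u = 3 * b * c2 + 2 * a * c1], the last
   product is [- 3 * (u ^+ 2 - a ^+ 2)], which cancels those in [c1]. *)
transitivity (6 * a * (2 * a ^+ 2 * c2 ^+ 2 - 6 * b * c1 * c2
                       - 2 * a * (c1 ^+ 2 + 2 * c2 * c0) + 3 * c0 ^+ 2 + 2 * a)
              - 2 * a * (3 * c0 - 2 * a * c2) ^+ 2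
              - (- 3 * b * c2 - 2 * a * c1 - a) * (9 * b * c2 + 6 * a * c1 - 3 * a)).
  by ring.
by rewrite E1 E2 E3; ring.
Qed.

Lemma irreducible_root_size (F : fieldType) (f : {poly F}) (r : F) :
  irreducible_poly f -> root f r -> size f = 2.
Proof.
move=> [_ irr]; rewrite root_factor_theorem => /irr.
by rewrite size_XsubC => /(_ isT)/eqp_size <-; rewrite size_XsubC.
Qed.

(** The prime subfield [1%AS] has [p] elements, so it is exactly the fixed set of the [p]-th power
    map. *)
Lemma expf_prime_fixed (p : nat) (L : fieldExtType 'F_p) (r : L) :
  prime p -> r ^+ p = r -> exists k : 'F_p, r = k%:A.
Proof.
move=> p_pr rp; apply/vlineP; rewrite (Fermat's_little_theorem 1%AS).
by rewrite dimv1 expn1 card_Fp // rp.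
Qed.

Lemma size_cubic_mod (p : nat) (a b : int) : size (cubic_mod p a b) = 4.
Proof.
rewrite /cubic_mod -addrA size_polyDl size_polyXn //.
by rewrite size_MXaddC size_polyC; case: ifP => // _; case: (_ == _).
Qed.

Lemma horner_cubic_mod (p : nat) (L : fieldExtType 'F_p) (a b : int) (x : L) :
  (map_poly (in_alg L) (cubic_mod p a b)).[x] = x ^+ 3 + a%:~R * x + b%:~R.
Proof.
rewrite /cubic_mod !rmorphD /= [X in _ + X + _]rmorphM /=.
by rewrite map_polyXn map_polyX !map_polyC /= !hornerE !scaler_int.
Qed.

Lemma horner_quadratic_mod (p : nat) (L : fieldExtType 'F_p) (c2 c1 c0 : int) (x : L) :
  (map_poly (in_alg L) (quadratic_mod p c2 c1 c0)).[x] =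
    c2%:~R * x ^+ 2 + c1%:~R * x + c0%:~R.
Proof.
rewrite /quadratic_mod !rmorphD /= [X in X + _ + _]rmorphM [X in _ + X + _]rmorphM /=.
by rewrite map_polyXn map_polyX !map_polyC /= !hornerE !scaler_int.
Qed.

(** A root fixed by Frobenius would lie in ['F_p] and split off a linear factor. *)
Lemma irreducible_cubic_expf_neq (p : nat) (L : fieldExtType 'F_p) (a b : int) (x : L) :
    prime p -> irreducible_poly (cubic_mod p a b) ->
    x ^+ 3 + a%:~R * x + b%:~R = 0 -> x ^+ p != x.
Proof.
move=> p_pr irr fx; apply/eqP => /(expf_prime_fixed p_pr)[k xE].
have kroot : root (cubic_mod p a b) k.
  by rewrite -(fmorph_root (in_alg L)) /= -xE rootE horner_cubic_mod fx.
by have := irreducible_root_size irr kroot; rewrite size_cubic_mod.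
Qed.

(** Subtracting the equations of [x] and [y] and cancelling [x - y] determines [a], then [b]. The
    cubic thus factors with third root [- x - y], as it has no quadratic term. *)
Lemma cubic_third_root (F : fieldType) (a b x y w : F) :
    x ^+ 3 + a * x + b = 0 -> y ^+ 3 + a * y + b = 0 ->
    w ^+ 3 + a * w + b = 0 -> x != y ->
  [/\ x * y + y * (- x - y) + (- x - y) * x = a, x * y * (- x - y) = - b
    & [|| w == x, w == y | w == - x - y]].
Proof.
move=> fx fy fw neq_xy.
have aE : a = - (x ^+ 2 + x * y + y ^+ 2).
  apply: (mulfI (_ : x - y != 0)); first by rewrite subr_eq0.
  apply/eqP; rewrite -subr_eq0; apply/eqP.
  transitivity ((x ^+ 3 + a * x + b) - (y ^+ 3 + a * y + b)); first by ring.
  by rewrite fx fy subr0.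
have bE : b = x * y * (x + y).
  apply/eqP; rewrite -subr_eq0; apply/eqP; rewrite -fx aE; ring.
split; [by rewrite aE; ring | by rewrite bE; ring |].
have: (w - x) * ((w - y) * (w - (- x - y))) = 0 by rewrite -fw aE bE; ring.
by move/eqP; rewrite !mulf_eq0 !subr_eq0.
Qed.

Lemma frobenius_cycles_cubic_roots (p : nat) (L : fieldExtType 'F_p) (a b : int) (x : L) :
    prime p -> irreducible_poly (cubic_mod p a b) ->
    x ^+ 3 + a%:~R * x + b%:~R = 0 ->
  exists y z : L, [/\ [/\ x ^+ p = y, y ^+ p = z & z ^+ p = x],
    x + y + z = 0, x * y + y * z + z * x = a%:~R & x * y * z = - b%:~R].
Proof.
move=> p_pr irr fx.
have charL : p \in [pchar L] by rewrite pchar_lalg pchar_Fp.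
(* Frobenius is a ring morphism fixing the integer coefficients, so it maps roots to roots. *)
have rootX w : w ^+ 3 + a%:~R * w + b%:~R = 0 ->
    (w ^+ p) ^+ 3 + a%:~R * w ^+ p + b%:~R = 0 :> L.
  move=> fw; rewrite -(pFrobenius_autE charL) -[in LHS](pFrobenius_aut_int charL a).
  by rewrite -[in LHS](pFrobenius_aut_int charL b) -rmorphXn -rmorphM -!rmorphD fw rmorph0.
have neqX w : w ^+ 3 + a%:~R * w + b%:~R = 0 -> w ^+ p != w :> L.
  exact: irreducible_cubic_expf_neq.
have fy := rootX _ fx; have fz := rootX _ fy.
have neq_xy : x != x ^+ p by rewrite eq_sym neqX.
have [e2 e3 cases] := cubic_third_root fx fy fz neq_xy.
have zX : (- x - x ^+ p) ^+ p = - x ^+ p - (x ^+ p) ^+ p.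
  by rewrite -!(pFrobenius_autE charL) rmorphB rmorphN.
have f3 : (- x - x ^+ p) ^+ 3 + a%:~R * (- x - x ^+ p) + b%:~R = 0.
  by rewrite -fx -e2 -[b%:~R]opprK -e3; ring.
(* If Frobenius swapped [x] and [x ^+ p], it would fix the third root. *)
have zE : (x ^+ p) ^+ p = - x - x ^+ p.
  case/or3P: cases => /eqP // zE; last by have := neqX _ fy; rewrite zE eqxx.
  by have := neqX _ f3; rewrite zX zE addrC eqxx.
exists (x ^+ p), (- x - x ^+ p); split=> //; last by ring.
by split=> //; rewrite zX zE; ring.
Qed.

Lemma eqz_mod_pchar (R : nzRingType) (p : nat) (m n : int) :
  p \in [pchar R] -> (m = n %[mod p%:Z])%Z <-> m%:~R = n%:~R :> R.
Proof.
move=> charR; rewrite (rwP eqP) eqz_mod_dvd (dvdz_pcharf charR) rmorphB subr_eq0.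
by rewrite -(rwP eqP).
Qed.

Unset Implicit Arguments.

Theorem theorem2 (p : nat) (a b : int) (p_prime : prime p) (p_ge5 : (5 <= p)%N)
    (a_coprime_p : gcdz a p%:Z = 1)
    (f_irr : irreducible_poly (cubic_mod p a b))
    (c0 c1 c2 : int)
    (Xp_mod : 'X^p %% cubic_mod p a b
              = quadratic_mod p c2 c1 c0 %% cubic_mod p a b) :
  (exists d : int, (c2 * d = 1 %[mod p%:Z])%Z) /\
  (forall d t : int,
     (c2 * d = 1 %[mod p%:Z])%Z ->
     (t = 3 * a * d %[mod p%:Z])%Z ->
     (t ^+ 2 = - (4 * a ^+ 3 + 27 * b ^+ 2) %[mod p%:Z])%Z).
Proof.
have charF : p \in [pchar 'F_p] by rewrite pchar_Fp.
pose A : 'F_p := a%:~R; pose B : 'F_p := b%:~R; pose C : 'F_p := c2%:~R.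
have key : C ^+ 2 * (4 * A ^+ 3 + 27 * B ^+ 2) = - (9 * A ^+ 2).
  have [L _ [x xroot _]] := irredp_FAdjoin f_irr.
  have fx : x ^+ 3 + a%:~R * x + b%:~R = 0.
    by rewrite -horner_cubic_mod; apply/eqP.
  (* Both ['X^p] and the quadratic are divided by the cubic; at a root the quotient terms vanish and
     the equal remainders are left. *)
  have Xp w : w ^+ 3 + a%:~R * w + b%:~R = 0 ->
      c2%:~R * w ^+ 2 + c1%:~R * w + c0%:~R = w ^+ p :> L.
    move=> fw; rewrite -horner_quadratic_mod.
    have/(congr1 (fun q => (map_poly (in_alg L) q).[w])) := divp_eq 'X^p (cubic_mod p a b).
    rewrite Xp_mod map_polyXn hornerXn => ->.
    rewrite [in LHS](divp_eq (quadratic_mod p c2 c1 c0) (cubic_mod p a b)).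
    by rewrite !rmorphD !rmorphM /= !hornerD !hornerM horner_cubic_mod fw !mulr0 !add0r.
  have [y [z [[xy yz zx] e1 e2 e3]]] := frobenius_cycles_cubic_roots p_prime f_irr fx.
  have fy : y ^+ 3 + a%:~R * y + b%:~R = 0.
    by rewrite -e2 -[b%:~R]opprK -e3 -[z](addKr (x + y)) e1; ring.
  have fz : z ^+ 3 + a%:~R * z + b%:~R = 0.
    by rewrite -e2 -[b%:~R]opprK -e3 -[z](addKr (x + y)) e1; ring.
  have := quadratic_cycle_discriminant e1 e2 e3.
  move=> /(_ _ _ _ (etrans (Xp x fx) xy) (etrans (Xp y fy) yz) (etrans (Xp z fz) zx)) keyL.
  (* The identity in [L] involves only images of integers, so it descends along the injection of
     ['F_p]. *)
  apply: (fmorph_inj (in_alg L)).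
  by rewrite !(rmorph_nat, rmorph_int, rmorphXn, rmorphN, rmorphM, rmorphD).
have natF_neq0 k : (0 < k < p)%N -> k%:R != 0 :> 'F_p.
  case/andP=> k_gt0 lt_kp; rewrite -(dvdn_pcharf charF).
  by apply: contraL lt_kp => /(dvdn_leq k_gt0); rewrite leqNgt.
have A_neq0 : A != 0.
  rewrite -(dvdz_pcharf charF); apply/negP => dvd_pa.
  have := dvdz_gcd p%:Z a p%:Z.
  rewrite a_coprime_p dvd_pa dvdzz dvdz1 absz_nat => /eqP p1.
  by rewrite p1 in p_ge5.
have C_neq0 : C != 0.
  have lt3p : (0 < 3 < p)%N by rewrite (leq_trans _ p_ge5).
  (* If [C] vanished, [key] would give [9 * A ^+ 2 = 0]; but 9 = 3 * 3, and both 3 and [A] are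
     nonzero in ['F_p]. *)
  apply/eqP => C0; have /eqP := key; rewrite C0 expr0n mul0r eq_sym oppr_eq0.
  rewrite mulf_eq0 expf_eq0 (negPf A_neq0) orbF (natrM _ 3 3) mulf_eq0 orbb.
  by rewrite (negPf (natF_neq0 _ lt3p)).
split.
  (* The witness is the representative of [C^-1] below [p]. *)
  exists (nat_of_ord C^-1); apply/(eqz_mod_pchar _ _ charF).
  by rewrite rmorphM /= -/C -pmulrn natr_Zp divff.
move=> d t /(eqz_mod_pchar _ _ charF) + /(eqz_mod_pchar _ _ charF).
rewrite !(rmorph_nat, rmorphM) /= -/C -/A => Cd tE; apply/(eqz_mod_pchar _ _ charF).
rewrite !(rmorph_nat, rmorphXn, rmorphN, rmorphM, rmorphD) /= tE -/A -/B.
set D := d%:~R in Cd *.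
transitivity (- (- (9 * A ^+ 2) * D ^+ 2)); first by ring.
rewrite -key.
transitivity (- (4 * A ^+ 3 + 27 * B ^+ 2) * (C * D) ^+ 2); first by ring.
by rewrite Cd; ring.
Qed.
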